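(* For every integer $k\ge 1$, the sequence $(a_k(n))_{n\ge 1}$ is subadditive, i.e. $a_k(n+m)\le a_k(n)+a_k(m)$ for all integers $m,n\ge 1$, and the limit $f(k)=\lim_{n\to\infty}\frac{a_k(n)}{n}$ exists and satisfies $\frac{k}{4}\le f(k)\le \frac{k}{3}$.
   Context: Let $P\subset\mathbb{Z}^2$ be a finite set of grid points. There are four directions: horizontal $(1,0)$, vertical $(0,1)$, and the two diagonals $(1,1)$ and $(1,-1)$. For a direction $d$ and an integer $k\ge 1$, a line segment of length $k$ of $P$ in direction $d$ is a set $\{p,p+d,\dots,p+(k-1)d\}\subseteq P$ such that $p-d\notin P$ and $p+kd\notin P$ (a maximal run of exactly $k$ points). Segments are counted separately for each direction, so that an isolated point gives $4$ line segments of length $1$. For integers $k,n\ge 1$, $a_k(n)$ denotes the minimal cardinality of a finite set $P\subset\mathbb{Z}^2$ that has at least $n$ line segments of length $k$ (counted over all four directions). *)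

(* Defs.v *)
From HB Require Import structures.
From mathcomp Require Import all_boot all_order all_algebra finmap.
From mathcomp Require Import boolp classical_sets reals topology normedtype
  sequences.
Set Implicit Arguments.
Unset Strict Implicit.
Unset Printing Implicit Defensive.
Import Order.TTheory GRing.Theory Num.Theory.
Import numFieldNormedType.Exports.
Local Open Scope fset_scope.
Local Open Scope ring_scope.

Definition point : Type := (int * int)%type.

Definition directions : seq point := [:: (1, 0); (0, 1); (1, 1); (1, -1)].

Definition run (d : point) (k : nat) (p : point) : {fset point} :=
  [fset p + d *+ i | i in iota 0 k].

(* Segments are point sets, not starting points; for 0 < k the restriction of
   the starting point p to P is implied by run d k p `<=` P. *)
Definition segments (P : {fset point}) (d : point) (k : nat) :
    {fset {fset point}} :=
  [fset run d k p | p in P &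
    [&& run d k p `<=` P, p - d \notin P & p + d *+ k \notin P]].

Definition nsegments (P : {fset point}) (k : nat) : nat :=
  (\sum_(d <- directions) #|` segments P d k|)%N.

Definition is_min_card (k n m : nat) : Prop :=
  (exists P : {fset point}, #|` P| = m /\ (n <= nsegments P k)%N) /\
  (forall P : {fset point}, (n <= nsegments P k)%N -> (m <= #|` P|)%N).

(* The default value 0 is never used for 0 < k: see min_cardP below. *)
Definition min_card (k n : nat) : nat :=
  xget 0%N [set m : nat | is_min_card k n m]%classic.

Lemma exists_nsegments (k n : nat) : (0 < k)%N ->
  exists P : {fset point}, (n <= nsegments P k)%N.
Proof.
move=> k0.
pose P : {fset point} :=
  [fset ((i%:Z, (2 * j)%:Z) : point) | i in iota 0 k, j in iota 0 n].
have inP (x y : int) : ((x, y) : point) \in P ->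
    exists i j : nat, [/\ (i < k)%N, (j < n)%N, x = i%:Z & y = (2 * j)%:Z].
  case/imfset2P => i /= + [j /= + [-> ->]].
  by rewrite !mem_iota /= !add0n => ik jn; exists i, j.
have runE (j i : nat) :
    (((0, (2 * j)%:Z) : point) + ((1, 0) : point) *+ i) = (i%:Z, (2 * j)%:Z).
  have -> : ((1, 0) : point) *+ i = (i%:Z, 0).
    elim: i => [|i IH]; first by rewrite mulr0n.
    rewrite mulrS IH; congr pair; rewrite /= ?addr0 //.
  by congr pair; rewrite /= ?add0r ?addr0.
exists P; rewrite /nsegments /directions big_cons.
apply: leq_trans (leq_addr _ _).
pose S (j : nat) : {fset point} := run (1, 0) k (0, (2 * j)%:Z).
have Sinj : injective S.
  move=> j j' eS.
  have : ((0, (2 * j)%:Z) : point) \in S j.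
    by apply/imfsetP; exists 0%N; rewrite ?mulr0n ?addr0 //= mem_iota /= add0n.
  rewrite eS => /imfsetP[i _]; rewrite runE => -[_ /eqP].
  by rewrite eqn_pmul2l // => /eqP.
have <- : #|` [fset S j | j in iota 0 n]| = n.
  by rewrite card_imfset //= undup_id ?iota_uniq// size_iota.
apply: fsubset_leq_card; apply/fsubsetP => _ /imfsetP[j /= + ->].
rewrite mem_iota /= add0n => jn.
apply/imfsetP; exists (0, (2 * j)%:Z) => //=.
rewrite !inE /=; apply/and4P; split.
- apply/imfset2P; exists 0%N; first by rewrite /= mem_iota.
  by exists j => //=; rewrite mem_iota.
- apply/fsubsetP => _ /imfsetP[i /= ik ->]; rewrite runE.
  by apply/imfset2P; exists i => //; exists j => //=; rewrite mem_iota.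
- by apply/negP => /inP[i [j' []]].
- rewrite runE; apply/negP => /inP[i [j' [ik _ [ki] _]]].
  by rewrite ki ltnn in ik.
Qed.

Lemma min_cardP (k n : nat) : (0 < k)%N -> is_min_card k n (min_card k n).
Proof.
move=> k0; suff [m mP] : exists m, is_min_card k n m.
  by rewrite /min_card; case: xgetP => [x _ //|/(_ m)].
have ex : exists m, `[< exists P : {fset point},
    #|` P| = m /\ (n <= nsegments P k)%N >].
  have [P nP] := exists_nsegments n k0.
  by exists #|` P|; apply/asboolP; exists P.
case: (ex_minnP ex) => m /asboolP mP mmin; exists m; split=> // P nP.
by apply: mmin; apply/asboolP; exists P.
Qed.

(* Main.v *)
(* Placing two sets far apart horizontally adds up their segments, so a_k is
   subadditive and a_k(n)/n tends to its infimum (Fekete).  Segments of a given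
   direction are pairwise disjoint, so each direction has at most |P|/k of them,
   whence a_k(n) >= nk/4.  In a vertical strip of width k and height n every
   horizontal run and, up to O(k) exceptions near the ends, every diagonal run
   in both directions has exactly k points; this gives about 3n segments on kn
   points. *)
Require Import Defs.
From HB Require Import structures.
From mathcomp Require Import all_boot all_order all_algebra finmap.
From mathcomp Require Import boolp classical_sets reals topology normedtype
  sequences.
From mathcomp Require Import zify lra.
Set Implicit Arguments.
Unset Strict Implicit.
Unset Printing Implicit Defensive.
Import Order.TTheory GRing.Theory Num.Theory.
Import numFieldNormedType.Exports.
Local Open Scope ring_scope.
Local Open Scope classical_set_scope.

(** * Fekete's lemma for nonnegative subadditive sequences *)

Lemma fekete (R : realType) (u : nat -> R) :
  (forall n, 0 <= u n) -> (forall m n, u (m + n)%N <= u m + u n) ->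
  u n / n%:R @[n --> \oo] --> inf [set u n / n%:R | n in [set n | (0 < n)%N]].
Proof.
move=> u0 uD; set E := [set _ | _ in _].
have Elb : lbound E 0 by move=> _ [n _ <-]; rewrite divr_ge0.
have E0 : E !=set0 by exists (u 1%N / 1%:R), 1%N.
(* To be used with the Euclidean division [n = q * N + r], where [N] stays fixed while [n] grows. *)
have uM N q r : u (q * N + r)%N <= q%:R * u N + u r.
  elim: q => [|q IH]; first by rewrite mul0r add0r.
  rewrite mulSn -addnA -natr1 mulrDl mul1r [_ + u N]addrC -addrA.
  by rewrite (le_trans (uD _ _))// lerD2l.
apply/cvgrPdist_le => e e0.
have e20 : 0 < e / 2 by rewrite divr_gt0.
have [_ [N /= N0 <-] ltN] := inf_adherent e20 (conj E0 (ex_intro _ 0 Elb)).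
(* The remainder [n %% N] takes only finitely many values, so its contribution is bounded; as [u] is
   nonnegative, the sum of these values is a crude bound. *)
have [C ltC] : exists C, forall r, (r < N)%N -> u r <= C.
  exists (\sum_(r < N) u r) => r rN.
  by rewrite (bigD1 (Ordinal rN))//= lerDl sumr_ge0.
near=> n.
have n0 : (0 < n)%N by near: n; exact: nbhs_infty_gt.
have n0R : 0 < n%:R :> R by rewrite ltr0n.
have infle : inf E <= u n / n%:R.
  by apply: ge_inf; [exists 0 | exists n].
rewrite ler_distlC lerBlDr (le_trans infle) ?lerDl ?(ltW e0)//=.
rewrite ler_pdivrMr// {1}(divn_eq n N) (le_trans (uM _ _ _))//.
(* The error [e] is split evenly: one half is the distance of [u N / N] from the infimum, the other
   absorbs [C / n] for large [n]. *)
have qle : (n %/ N)%:R * u N <= n%:R * (u N / N%:R).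
  rewrite mulrCA [leLHS]mulrC ler_wpM2l// ler_pdivlMr ?ltr0n// -natrM ler_nat.
  exact: leq_divM.
have Cle : u (n %% N)%N <= n%:R * (e / 2).
  rewrite (le_trans (ltC _ _)) ?ltn_pmod//.
  rewrite -ler_pdivrMr//; apply: ltW; near: n; exact: nbhs_infty_gtr.
rewrite (le_trans (lerD qle Cle))// -mulrDr mulrC ler_pM2r//.
by rewrite {2}(splitr e) addrA lerD2r ltW.
Unshelve. all: by end_near. Qed.

(** * Segments of one direction and the counting bound *)

Local Open Scope fset_scope.
Local Open Scope ring_scope.
(* [topology] has its own [point]. *)
Local Notation point := Defs.point.

Lemma runP (d : point) (k : nat) (p q : point) :
  reflect (exists2 i, (i < k)%N & q = p + d *+ i) (q \in run d k p).
Proof.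
apply: (iffP (imfsetP _ _ _ _)) => [[i /= + ->]|[i ik ->]].
  by rewrite mem_iota add0n => ik; exists i.
by exists i; rewrite //= mem_iota.
Qed.

Lemma segmentsP (P : {fset point}) (d : point) (k : nat) (s : {fset point}) :
  reflect (exists p, [/\ p \in P, run d k p `<=` P, p - d \notin P,
    p + d *+ k \notin P & s = run d k p]) (s \in segments P d k).
Proof.
apply: (iffP (imfsetP _ _ _ _)) => [[p /= + ->]|[p [pP sP bP eP ->]]].
  by rewrite !inE => /and4P[]; exists p.
by exists p => //=; rewrite !inE; apply/and4P.
Qed.

(** With [S] the set of starting points of segments, the points [p + d *+ i] for [p] in [S] and
    [i < k] all lie in [P] and are pairwise distinct, because two maximal runs that meet have the
    same start. *)
Lemma card_segments (P : {fset point}) (d : point) (k : nat) :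
  (#|` segments P d k| * k <= #|` P|)%N.
Proof.
pose S := [fset p in P |
  [&& run d k p `<=` P, p - d \notin P & p + d *+ k \notin P]].
have leS : (#|` segments P d k| <= #|` S|)%N.
  apply: (@leq_trans #|` [fset run d k p | p in S]|);
    last exact: leq_imfset_card.
  apply/fsubset_leq_card/fsubsetP => _ /segmentsP[p [pP sP bP eP ->]].
  by apply/imfsetP; exists p => //=; rewrite !inE; apply/and4P.
apply: leq_trans (leq_mul leS (leqnn k)) _.
have -> : (#|` S| * k)%N =
    size [seq (p + d *+ i : point) | p <- S, i <- iota 0 k].
  by rewrite size_allpairs size_iota.
(* A maximal run cannot start inside another one: the point before it would
   lie in P. *)
have sep (p q : point) i j : p \in S -> q \in S -> (j < k)%N ->
    p + d *+ i = q + d *+ j -> (j <= i)%N.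
  rewrite !inE => /and4P[_ _ pP _] /and4P[_ /fsubsetP qP _ _] jk epq.
  rewrite leqNgt; apply/negP => ij; move/negP: pP; apply.
  (* From [p + d *+ i = q + d *+ j] and [i < j] one gets [p - d = q + d *+ (j - i - 1)], a point of
     the run from [q]. *)
  apply: qP; apply/runP; exists (j - i.+1)%N; first by lia.
  apply: (addIr d); rewrite subrK; apply: (addIr (d *+ i)).
  by rewrite epq -!addrA -mulrS -mulrnDr subnK.
apply: uniq_leq_size => [|_ /allpairsP[[p i] /= [pS + ->]]].
  apply: allpairs_uniq => [||[p i] [q j]]; rewrite ?iota_uniq//;
    first exact: fset_uniq.
  move=> /allpairsP[[? ?] /= [pS + [-> ->]]].
  move=> + /allpairsP[[? ?] /= [qS + [-> ->]]].
  rewrite !mem_iota !add0n => ik jk epq.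
  have eij := anti_leq (introT andP (conj
    (sep _ _ _ _ qS pS ik (esym epq)) (sep _ _ _ _ pS qS jk epq))).
  by move: epq; rewrite eij => /addIr->.
rewrite mem_iota add0n => ik; move: pS.
rewrite !inE => /and4P[_ /fsubsetP sP _ _].
by apply: sP; apply/runP; exists i.
Qed.

Lemma nsegments_le (P : {fset point}) (k : nat) :
  (nsegments P k * k <= 4 * #|` P|)%N.
Proof.
rewrite /nsegments big_distrl /=.
apply: leq_trans (leq_sum _ (fun d _ => card_segments P d k)) _.
by rewrite big_const_seq count_predT iter_addn_0 mulnC.
Qed.

(** * Separated unions, translations and subadditivity *)

(** A run of [P] could lose maximality only if [Q] contained one of the two points just beyond its
    ends. Since [0 < k], both are neighbours of points of [P]: the far one is the last point of the
    run plus [d]. *)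
Lemma segments_fsetU (P Q : {fset point}) (d : point) (k : nat) : (0 < k)%N ->
  (forall p, p \in P -> (p - d \notin Q) && (p + d \notin Q)) ->
  segments P d k `<=` segments (P `|` Q) d k.
Proof.
case: k => // k _ PQ; apply/fsubsetP => _ /segmentsP[p [pP sP bP eP ->]].
apply/segmentsP; exists p; split => //.
- by rewrite inE pP.
- exact: fsubset_trans sP (fsubsetUl _ _).
- by rewrite inE (negbTE bP); have /andP[] := PQ _ pP.
- rewrite inE (negbTE eP) mulrSr addrA.
  have /PQ/andP[] // : p + d *+ k \in P.
  by apply: (fsubsetP sP); apply/runP; exists k.
Qed.

Definition translate (v : point) (P : {fset point}) : {fset point} :=
  [fset v + p | p in P].

Lemma mem_translate (v p : point) (P : {fset point}) :
  (p \in translate v P) = (p - v \in P).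
Proof.
apply/imfsetP/idP => [[q /= qP ->]|pP]; first by rewrite [v + q]addrC addrK.
by exists (p - v); rewrite //= addrC subrK.
Qed.

Lemma translate_inj (v : point) : injective (translate v).
Proof.
move=> P Q eqPQ; apply/fsetP => p.
by rewrite -[p](addrK v) -!mem_translate eqPQ.
Qed.

Lemma card_translate (v : point) (P : {fset point}) : #|` translate v P| = #|` P|.
Proof. by rewrite card_imfset//; exact: addrI. Qed.

Lemma translate_run (v d p : point) (k : nat) :
  translate v (run d k p) = run d k (v + p).
Proof.
apply/fsetP => q; rewrite mem_translate.
apply/runP/runP => -[i ik e]; exists i => //.
  by rewrite -addrA -e addrC subrK.
by rewrite e -(addrA v) [v + _]addrC addrK.
Qed.

Lemma card_segments_translate (v : point) (P : {fset point}) (d : point)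
    (k : nat) : (#|` segments P d k| <= #|` segments (translate v P) d k|)%N.
Proof.
have <- : #|` [fset translate v s | s in segments P d k]| = #|` segments P d k|.
  by rewrite card_imfset//; exact: translate_inj.
apply/fsubset_leq_card/fsubsetP => _ /imfsetP[s /= sPd ->].
case/segmentsP: sPd => p [pP sP bP eP ->]; rewrite translate_run.
have vK q : v + q - v = q by rewrite [v + q]addrC addrK.
apply/segmentsP; exists (v + p); split => //.
- by rewrite mem_translate vK.
- rewrite -translate_run; apply/fsubsetP => q; rewrite !mem_translate.
  exact: (fsubsetP sP).
- by rewrite mem_translate -(addrA v) vK.
- by rewrite mem_translate -(addrA v) vK.
Qed.

(** Every direction changes the abscissa by 0 or 1, so an empty column between [P] and [Q] keeps all
    neighbours of one set out of the other. No segment is counted twice: its starting point would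
    lie in both sets. *)
Lemma nsegments_fsetU (P Q : {fset point}) (k : nat) : (0 < k)%N ->
  (forall p q, p \in P -> q \in Q -> p.1 + 1 < q.1) ->
  (nsegments P k + nsegments Q k <= nsegments (P `|` Q) k)%N.
Proof.
move=> k0 PQ; rewrite /nsegments -big_split /= big_seq [leqRHS]big_seq.
apply: leq_sum => d dD.
have d01 : (0 <= d.1 <= 1) by move: dD; rewrite !inE => /or4P[] /eqP->.
have dPQ : segments P d k `&` segments Q d k = fset0.
  apply/fsetP => s; rewrite !inE; apply/negP => /andP[].
  move=> /segmentsP[p [pP _ _ _ ->]] /segmentsP[q [_ /fsubsetP sQ _ _ e]].
  have /sQ pQ : p \in run d k q by rewrite -e;
    apply/runP; exists 0%N; rewrite ?addr0.
  by have := PQ _ _ pP pQ; lia.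
have := cardfsUI (segments P d k) (segments Q d k).
rewrite dPQ cardfs0 addn0 => <-.
apply/fsubset_leq_card; rewrite fsubUset; apply/andP; split.
  apply: segments_fsetU => // p pP; apply/andP; split; apply/negP => /(PQ _ _ pP);
  by case: p d d01 {pP dD dPQ} => [x y] [a b] /=; lia.
rewrite fsetUC; apply: segments_fsetU => // q qQ.
apply/andP; split; apply/negP => /PQ/(_ qQ);
by case: q d d01 {qQ dD dPQ} => [x y] [a b] /=; lia.
Qed.

Lemma fset_bounded (P : {fset point}) :
  exists M : nat, forall p, p \in P -> (absz p.1 <= M)%N.
Proof.
exists (\max_(p <- enum_fset P) absz p.1)%N => p pP.
exact: (@leq_bigmax_seq _ _ xpredT (fun p : point => absz p.1)).
Qed.

Lemma min_card_le (P : {fset point}) (k n : nat) : (0 < k)%N ->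
  (n <= nsegments P k)%N -> (min_card k n <= #|` P|)%N.
Proof. by move=> k0; have [_] := min_cardP n k0; apply. Qed.

Lemma min_card_subadditive (k m n : nat) : (0 < k)%N ->
  (min_card k (m + n) <= min_card k m + min_card k n)%N.
Proof.
move=> k0; have [[P [<- mP]] _] := min_cardP m k0.
have [[Q [<- nQ]] _] := min_cardP n k0.
have [[M HM] [N HN]] := (fset_bounded P, fset_bounded Q).
(* Abscissas are at most [M] on [P] and at least [-N] on [Q]; after the shift those of [Q'] are at
   least [M + 2]. *)
pose Q' := translate (M%:Z + N%:Z + 2, 0) Q.
rewrite -(card_translate (M%:Z + N%:Z + 2, 0) Q) -/Q'.
apply: (@leq_trans #|` P `|` Q'|); last by rewrite cardfsU leq_subr.
apply: min_card_le => //; apply: leq_trans (nsegments_fsetU k0 _).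
  apply: leq_add => //; apply: leq_trans nQ _.
  by apply: leq_sum => d _; exact: card_segments_translate.
move=> p q pP; rewrite mem_translate => qQ.
have := HM _ pP; have := HN _ qQ.
case: p q {pP qQ} => [x y] [x' y'] /=; lia.
Qed.

Lemma min_card_lower (k n : nat) : (0 < k)%N -> (n * k <= 4 * min_card k n)%N.
Proof.
move=> k0; have [[P [<- nP]] _] := min_cardP n k0.
by apply: leq_trans (nsegments_le P k); rewrite leq_mul2r nP orbT.
Qed.

(** * The strip construction and the upper bound *)

Definition strip (k n : nat) : {fset point} :=
  [fset ((i%:Z, j%:Z) : point) | i in iota 0 k, j in iota 0 n].

Lemma mem_strip (k n : nat) (x y : int) :
  (((x, y) : point) \in strip k n) = (0 <= x < k%:Z) && (0 <= y < n%:Z).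
Proof.
apply/imfset2P/idP => [[i /= + [j /= + [-> ->]]]|xy].
  by rewrite !mem_iota; lia.
exists (absz x); first by rewrite /= mem_iota; lia.
exists (absz y); first by rewrite /= mem_iota; lia.
by congr pair; lia.
Qed.

Lemma card_strip (k n : nat) : #|` strip k n| = (k * n)%N.
Proof.
have /perm_size -> : perm_eq (strip k n)
    [seq ((i%:Z, j%:Z) : point) | i <- iota 0 k, j <- iota 0 n].
  apply: uniq_perm; first exact: fset_uniq.
    by apply: allpairs_uniq => [||[i j] [i' j'] _ _ [-> ->]]; rewrite ?iota_uniq.
  move=> p; apply/imfset2P/allpairsP => [[i ik [j jn ->]]|[[i j] /= [ik jn ->]]].
    by exists (i, j).
  by exists i => //; exists j.
by rewrite size_allpairs !size_iota.
Qed.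

(** A run of slope [e] from column 0 crosses all [k] columns, and the points beyond its ends lie in
    columns [-1] and [k]. Maximality is thus automatic, and only the ordinates have to be checked;
    [s] lists the starting rows. *)
Lemma card_segments_strip (k n : nat) (e : int) (s : seq nat) : (0 < k)%N ->
  uniq s ->
  (forall j i : nat, j \in s -> (i < k)%N -> 0 <= j%:Z + e *+ i < n%:Z) ->
  (size s <= #|` segments (strip k n) (1, e)%R k|)%N.
Proof.
move=> k0 us sn.
have mulE i : ((1, e) : point) *+ i = (i%:Z, e *+ i).
  elim: i => [|i IH]; first by rewrite !mulr0n.
  by rewrite !mulrS IH; congr pair; rewrite /=; lia.
pose S (j : nat) := run (1, e) k (0, j%:Z).
have Sinj : injective S.
  move=> j j' eS; have : ((0, j%:Z) : point) \in S j.
    by apply/runP; exists 0%N; rewrite ?addr0.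
  rewrite eS => /runP[i _]; rewrite mulE => -[/= i0]; have -> : i = 0%N by lia.
  by rewrite mulr0n; lia.
have <- : #|` [fset S j | j in s]| = size s.
  by rewrite card_imfset //= undup_id.
apply/fsubset_leq_card/fsubsetP => _ /imfsetP[j /= js ->].
apply/segmentsP; exists (0, j%:Z); split => //.
- by rewrite mem_strip; have := sn _ 0%N js k0; lia.
- apply/fsubsetP => _ /runP[i ik ->]; rewrite mulE mem_strip /=.
  by have := sn _ i js ik; lia.
- by rewrite mem_strip /=; lia.
- by rewrite mulE mem_strip /=; lia.
Qed.

(** Horizontal runs start in all [n] rows, rising diagonals in the lowest [n - k] and falling ones
    in the highest [n - k], so that [k - 1] further steps stay inside. If [n < k], the truncated
    differences are 0 and the horizontal runs suffice. *)
Lemma nsegments_strip (k n : nat) : (0 < k)%N ->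
  (3 * n - 2 * k <= nsegments (strip k n) k)%N.
Proof.
move=> k0; rewrite /nsegments /directions !big_cons big_nil.
have H0 : (size (iota 0 n) <= #|` segments (strip k n) (1, 0)%R k|)%N.
  apply: card_segments_strip => // [|j i]; first exact: iota_uniq.
  by rewrite mem_iota; lia.
have H1 : (size (iota 0 (n - k)) <= #|` segments (strip k n) (1, 1)%R k|)%N.
  apply: card_segments_strip => // [|j i]; first exact: iota_uniq.
  by rewrite mem_iota; lia.
have H2 : (size (iota k (n - k)) <= #|` segments (strip k n) (1, -1)%R k|)%N.
  apply: card_segments_strip => // [|j i]; first exact: iota_uniq.
  by rewrite mem_iota mulNrn; lia.
apply: leq_trans (leq_add H0 (leq_trans (leq_add H1 H2) _)); last first.
  by rewrite addn0; exact: leq_addl.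
rewrite !size_iota; lia.
Qed.

Lemma min_card_upper (k n : nat) : (0 < k)%N ->
  (3 * min_card k n <= k * (n + 2 * k + 3))%N.
Proof.
(* This height satisfies [n + 2 * k < 3 * N <= n + 2 * k + 3]: enough segments, at a cost that
   exceeds [k * n] by a constant independent of [n]. *)
move=> k0; pose N := ((n + 2 * k) %/ 3).+1.
have nN : (n <= nsegments (strip k N) k)%N.
  by apply: leq_trans (nsegments_strip N k0); rewrite /N; lia.
have := min_card_le k0 nN; rewrite card_strip => le1.
apply: leq_trans (_ : 3 * (k * N) <= _)%N; first by rewrite leq_mul2l le1.
by rewrite mulnCA leq_mul2l /N; apply/orP; right; lia.
Qed.

(** * The limit and its bounds *)

Local Open Scope classical_set_scope.

Theorem theorem1 (R : realType) (k : nat) (hk : (1 <= k)%N) :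
  (forall m n : nat, (1 <= m)%N -> (1 <= n)%N ->
     (min_card k (n + m) <= min_card k n + min_card k m)%N) /\
  exists f : R,
    [/\ (fun n : nat => (min_card k n)%:R / n%:R : R) @ \oo --> f,
        k%:R / 4%:R <= f & f <= k%:R / 3%:R].
Proof.
split=> [m n _ _|]; first exact: min_card_subadditive.
pose u n : R := (min_card k n)%:R.
exists (inf [set u n / n%:R | n in [set n | (0 < n)%N]]); split.
- apply: (@fekete _ u) => [n|m n]; first exact: ler0n.
  by rewrite -natrD ler_nat min_card_subadditive.
- apply: lb_le_inf => [|_ [n /= n0 <-]]; first by exists (u 1%N / 1%:R), 1%N.
  rewrite ler_pdivlMr ?ltr0n// mulrAC ler_pdivrMr ?ltr0n// -!natrM ler_nat.
  by rewrite mulnC [leqRHS]mulnC min_card_lower.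
(* The limit is an infimum, so a single [n] with [u n / n <= k / 3 + e] suffices. The upper bound
   gives [u n / n <= k / 3 + C / (3 * n)], and [n] is chosen with [C <= e * n]; the successor makes
   it positive. *)
- apply/ler_addgt0Pr => e e0.
  pose C : R := (k * (2 * k + 3))%:R.
  pose n := (Num.bound (C / e)).+1.
  have n0R : 0 < n%:R :> R by rewrite ltr0n.
  have Cn : C <= e * n%:R.
    rewrite mulrC -ler_pdivrMr//; apply: (@le_trans _ _ (Num.bound (C / e))%:R).
      by rewrite ltW// archi_boundP// divr_ge0// ltW.
    by rewrite ler_nat.
  apply: (@le_trans _ _ (u n / n%:R)).
    apply: ge_inf; last by exists n.
    by exists 0 => _ [m _ <-]; rewrite divr_ge0.
  have := min_card_upper n hk; rewrite -addnA mulnDr -(ler_nat R).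
  rewrite natrD -/C !natrM -/(u n) => le3.
  rewrite ler_pdivrMr// mulrDl.
  by have C0 : 0 <= C := ler0n _ _; lra.
Qed.
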